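(* Let $k\ge 1$. I. Let $\phi:[0,\infty)\times E_k\to E_k$ be a continuous vector function such that, with $\psi(\eta):=\phi(1,\eta)$, $$\phi(0,\eta)=\eta,\qquad \phi(t,\eta+q)=\phi(t,\eta)+q,\qquad \psi(\eta+q)=\psi(\eta)+q,\qquad \phi(t+1,\eta)=\phi(t,\psi(\eta))$$ for all $t\ge 0$, $\eta\in E_k$, $q\in\mathbb{Z}^k$. Let $\Phi(t,\eta)=\phi(t,\eta)$ for $0\le t\le 1$, $\eta\in E_k$. Then the continuous vector function $\Phi$ satisfies: a) $\Phi(t,\eta+q)=\Phi(t,\eta)+q$ for all $t\in[0,1]$, $\eta\in E_k$, $q\in\mathbb{Z}^k$; b) $\Phi(0,\eta)=\eta$ and $\Phi(1,\eta)=\psi(\eta)$ for all $\eta\in E_k$. II. Conversely, let $\Phi:[0,1]\times E_k\to E_k$ be a continuous vector function satisfying a) and b), where $\psi(\eta)=\Phi(1,\eta)$. Then the solution $\phi$ of the generalised system whose restriction to $0\le t\le 1$ is $\Phi$ is recovered in explicit form by the formula $$\phi(t+n,\eta)=\Phi(t,\psi_n(\eta))\qquad (0\le t\le 1,\ \eta\in E_k,\ n=0,1,2,\dots),$$ where $\psi_0(\eta)=\eta$ and $\psi_n(\eta)=\psi(\psi_{n-1}(\eta))$ for $n\ge1$. This $\phi$ is continuous on $[0,\infty)\times E_k$ and satisfies $\phi(0,\eta)=\eta$, $\phi(1,\eta)=\psi(\eta)$, $\phi(t,\eta+q)=\phi(t,\eta)+q$, $\psi(\eta+q)=\psi(\eta)+q$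 and $\phi(t+1,\eta)=\phi(t,\psi(\eta))$ for all $t\ge0$, $\eta\in E_k$, $q\in\mathbb{Z}^k$.
   Context: $E_k$ denotes the space $\mathbb{R}^k$ of real vectors $X=[x_1,\dots,x_k]$ with norm $\|X\|=\max_{1\le p\le k}|x_p|$. Continuity of functions of $t$ and $\eta$ means joint continuity in $(t,\eta)$. A solution of a generalised system is a continuous function $\phi:[0,\infty)\times E_k\to E_k$ such that, with $\psi(\eta)=\phi(1,\eta)$, one has $\phi(0,\eta)=\eta$, $\phi(t,\eta+q)=\phi(t,\eta)+q$, $\psi(\eta+q)=\psi(\eta)+q$ and $\phi(t+1,\eta)=\phi(t,\psi(\eta))$ for all $t\ge0$, $\eta\in E_k$, $q\in\mathbb{Z}^k$. No differentiability is required. *)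

(* Defs.v *)
From HB Require Import structures.
From mathcomp Require Import all_boot all_order all_algebra.
From mathcomp Require Import all_classical all_reals all_analysis.
Import Order.TTheory GRing.Theory Num.Theory numFieldNormedType.Exports.

Set Implicit Arguments.
Unset Strict Implicit.
Unset Printing Implicit Defensive.

Local Open Scope classical_set_scope.
Local Open Scope ring_scope.

Section GeneralisedSystem.
Variables (R : realType) (k : nat).

(* The library norm on row vectors is the max norm. *)
Local Notation E := 'rV[R]_k.

Definition intvec (q : 'rV[int]_k) : E := map_mx (fun z : int => z%:~R) q.

(* A function on I x E is encoded as a total function R -> E -> E; its values
   at times outside of I are irrelevant. *)
Definition jointly_continuous_on (I : set R) (f : R -> E -> E) : Prop :=
  {within I `*` [set: E], continuous (fun p : R * E => f p.1 p.2)}.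

Definition nonneg_times : set R := `[0, +oo[.

Definition unit_times : set R := `[0, 1].

Definition shift_equivariant (g : E -> E) : Prop :=
  forall (eta : E) (q : 'rV[int]_k), g (eta + intvec q) = g eta + intvec q.

Record generalised_solution (phi : R -> E -> E) (psi : E -> E) : Prop := {
  solution_continuous : jointly_continuous_on nonneg_times phi;
  solution_time1 : forall eta, phi 1 eta = psi eta;
  solution_time0 : forall eta, phi 0 eta = eta;
  solution_shift : forall t, nonneg_times t -> shift_equivariant (phi t);
  solution_psi_shift : shift_equivariant psi;
  solution_period : forall t eta, nonneg_times t ->
    phi (t + 1) eta = phi t (psi eta)
}.

Record fundamental_piece (Phi : R -> E -> E) (psi : E -> E) : Prop := {
  piece_continuous : jointly_continuous_on unit_times Phi;
  piece_shift : forall t, unit_times t -> shift_equivariant (Phi t);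
  piece_time0 : forall eta, Phi 0 eta = eta;
  piece_time1 : forall eta, Phi 1 eta = psi eta
}.

Definition restricts_to (phi Phi : R -> E -> E) : Prop :=
  forall t eta, unit_times t -> Phi t eta = phi t eta.

Definition recovery_formula (phi Phi : R -> E -> E) (psi : E -> E) : Prop :=
  forall (n : nat) (t : R) (eta : E), unit_times t ->
    phi (t + n%:R) eta = Phi t (iter n psi eta).

End GeneralisedSystem.

(* Main.v *)
Require Import Defs.
From mathcomp Require Import all_boot all_order all_algebra.
From mathcomp Require Import all_classical all_reals all_analysis.
Import Order.TTheory GRing.Theory Num.Theory numFieldNormedType.Exports.
Local Open Scope classical_set_scope.
Local Open Scope ring_scope.

(** A solution [phi] must agree with [Phi] on [[0, 1]], and the period relation
    [phi (t + 1) eta = phi t (psi eta)] transports its values from each unit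
    time interval to the next.  Iterating it [n] times gives the recovery
    formula ([recovery_of_solution]), which is therefore forced.

    For existence, the formula is read as a definition ([extension]): run [Phi]
    for the fractional part of the time, starting from the state reached after
    the integral part.  At an integer time two instances of the formula apply,
    one ending a unit interval and the other beginning the next one; they agree
    because [Phi 1 eta = psi eta] and [Phi 0 eta = eta] ([extension_recovery]).
    This agreement is also the source of continuity: on each closed slab
    [[n, n + 1] x E] the extension is the composite of [Phi] with a continuous
    map, and since consecutive closed slabs overlap in their common face, the
    pieces glue to a function continuous on [[0, oo[ x E]
    ([within_continuous_slabs]).  The algebraic properties are inherited from
    [Phi] because iterates of a shift-equivariant map are shift-equivariant. *)

Lemma within_continuous_precomp {U V W : topologicalType} (A : set U)
    (B : set V) (f : U -> V) (g : V -> W) :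
  continuous f -> (forall x, A x -> B (f x)) ->
  {within B, continuous g} -> {within A, continuous (g \o f)}.
Proof.
move=> cf fAB /subspace_continuousP cg; apply/subspace_continuousP => x Ax.
apply: cvg_comp (cg _ (fAB x Ax)) => S nS.
have {}nS : \forall y \near x, B (f y) -> S (f y) := cf x _ nS.
suff : \forall y \near x, A y -> S (f y) by [].
by apply: filterS nS => y nSy /fAB /nSy.
Qed.

Lemma continuous_pair {U V W : topologicalType} (f : U -> V) (g : U -> W) :
  continuous f -> continuous g -> continuous (fun x => (f x, g x)).
Proof. by move=> cf cg x; exact: cvg_pair (cf x) (cg x). Qed.

Lemma closed_slab {R : realType} {T : topologicalType} (a b : R) :
  closed (`[a, b] `*` [set: T]).
Proof.
have -> : `[a, b] `*` [set: T] = fst @^-1` `[a, b].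
  by apply/seteqP; split=> [x []|x].
apply: (preimage_closed _ (@itv_closed _ R a b)) => x _; exact: cvg_fst.
Qed.

(** Finitely many closed slabs glue by the pasting lemma for closed sets.
    Infinitely many cause no trouble, since continuity at a point of time [t]
    involves only the times below some integer larger than [t]. *)
Lemma within_continuous_slabs {R : realType} {T W : topologicalType}
    (f : R * T -> W) :
  (forall n : nat, {within `[n%:R, n.+1%:R] `*` [set: T], continuous f}) ->
  {within `[0, +oo[ `*` [set: T], continuous f}.
Proof.
move=> slab.
have initial n : {within `[0, n.+1%:R] `*` [set: T], continuous f}.
  elim: n => [|n IHn]; first exact: (slab 0).
  have -> : `[0 : R, n.+2%:R] `*` [set: T] =
      (`[0, n.+1%:R] `*` [set: T]) `|` (`[n.+1%:R, n.+2%:R] `*` [set: T]).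
    apply/seteqP; split=> -[t x] /=; rewrite !in_itv /=.
      case=> /andP[t0 tn] _.
      have [tn1|/ltW tn1] := leP t n.+1%:R; [left|right]; split=> //.
        by rewrite t0.
      by rewrite tn1.
    case=> -[/andP[ht htn] _]; split=> //; apply/andP; split=> //.
      by rewrite (le_trans htn)// ler_nat.
    exact: le_trans (ler0n _ _) ht.
  exact: withinU_continuous (@closed_slab _ _ _ _) (@closed_slab _ _ _ _) IHn
    (slab n.+1).
apply/subspace_continuousP => -[t x] [/= t0 _] S fS.
have {t0} t0 : 0 <= t by move: t0; rewrite in_itv /= andbT.
have /andP[_ tn] := truncn_itv t0.
have tx : (`[0, (Num.truncn t).+1%:R] `*` [set: T]) (t, x).
  by split; rewrite //= in_itv /= t0 ltW.
have /subspace_continuousP/(_ _ tx)/(_ _ fS) := initial (Num.truncn t).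
have before : \forall p \near (t, x), p.1 < (Num.truncn t).+1%:R :=
  @cvg_fst _ _ (nbhs t) (nbhs x) (nbhs_filter x) _ (lt_nbhsl tn).
move=> nS.
have {}nS : \forall p \near (t, x),
    (`[0, (Num.truncn t).+1%:R] `*` [set: T]) p -> S (f p) := nS.
suff : \forall p \near (t, x), (`[0, +oo[ `*` [set: T]) p -> S (f p) by [].
apply: filterS2 before nS => -[s y] /= sn hS [s0 _]; apply: hS; split=> //=.
by move: s0; rewrite !in_itv /= andbT => ->; exact: ltW.
Qed.

Section Solution.
Variables (R : realType) (k : nat).
Local Notation E := 'rV[R]_k.
Implicit Types (phi Phi : R -> E -> E) (psi : E -> E).

Lemma unit_nonneg_times (t : R) : unit_times t -> nonneg_times t.
Proof. by rewrite /unit_times /nonneg_times /= !in_itv /= => /andP[->]. Qed.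

Lemma unit_times0 : unit_times (0 : R).
Proof. by rewrite /unit_times /= in_itv /= lexx ler01. Qed.

Lemma unit_times1 : unit_times (1 : R).
Proof. by rewrite /unit_times /= in_itv /= lexx ler01. Qed.

Lemma piece_of_solution phi Phi psi :
  generalised_solution phi psi -> restricts_to phi Phi ->
  fundamental_piece Phi psi.
Proof.
move=> sol res; split.
- apply: (@subspace_eq_continuous _ _ _ (fun p : R * E => phi p.1 p.2)).
    by move=> p /set_mem [t01 _]; rewrite -res.
  apply: continuous_subspaceW (solution_continuous sol).
  by move=> p [/unit_nonneg_times].
- move=> t t01 eta q; rewrite !res //.
  exact/(solution_shift sol)/unit_nonneg_times.
- by move=> eta; rewrite res ?(solution_time0 sol)//; exact: unit_times0.
- by move=> eta; rewrite res ?(solution_time1 sol)//; exact: unit_times1.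
Qed.

Lemma recovery_of_solution phi Phi psi :
  generalised_solution phi psi -> restricts_to phi Phi ->
  recovery_formula phi Phi psi.
Proof.
move=> sol res n t eta t01.
have t0 := unit_nonneg_times _ t01.
rewrite res //; elim: n eta => [|n IHn] eta; first by rewrite addr0.
rewrite -natr1 addrA (solution_period sol) ?IHn -?iterSr//.
move: t0; rewrite /nonneg_times /= !in_itv /= !andbT => t0.
by rewrite addr_ge0.
Qed.

Definition extension Phi psi (t : R) (eta : E) : E :=
  Phi (t - (Num.truncn t)%:R) (iter (Num.truncn t) psi eta).

Lemma iter_shift psi n :
  shift_equivariant psi -> shift_equivariant (iter n psi).
Proof. by move=> psiq eta q; elim: n => //= n ->; rewrite psiq. Qed.

Lemma unit_times_frac (t : R) :
  nonneg_times t -> unit_times (t - (Num.truncn t)%:R).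
Proof.
rewrite /nonneg_times /unit_times /= !in_itv /= andbT => /truncn_itv.
by rewrite -natr1 => /andP[? /ltW ?]; rewrite subr_ge0 lerBlDl; apply/andP.
Qed.

Section Piece.
Variables (Phi : R -> E -> E) (psi : E -> E).
Hypothesis piece : fundamental_piece Phi psi.

Lemma psi_shift : shift_equivariant psi.
Proof.
move=> eta q; rewrite -!(piece_time1 piece).
exact/(piece_shift piece)/unit_times1.
Qed.

Lemma psi_continuous : continuous psi.
Proof.
have -> : psi = (fun p : R * E => Phi p.1 p.2) \o (fun eta => (1, eta)).
  by apply/funext => eta /=; rewrite (piece_time1 piece).
apply/continuous_subspace_setT.
apply: within_continuous_precomp (piece_continuous piece).
  by apply: continuous_pair => eta; [exact: cst_continuous | exact: cvg_id].
by move=> eta _; split=> //; exact: unit_times1.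
Qed.

Lemma iter_psi_continuous n : continuous (iter n psi).
Proof.
elim: n => [|n IHn] eta; first exact: cvg_id.
by apply: continuous_comp; [exact: IHn | exact: psi_continuous].
Qed.

Lemma extension_recovery : recovery_formula (extension Phi psi) Phi psi.
Proof.
move=> n t eta; rewrite /unit_times /= in_itv /= => /andP[t0].
rewrite /extension le_eqVlt => /predU1P[->|t1].
  (* The endpoint 1 + n is seen by the definition as the start of the interval
     of index n + 1, and by the formula as the end of the one of index n. *)
  rewrite nat1r natrK subrr (piece_time0 piece) /=.
  by rewrite (piece_time1 piece).
have -> : Num.truncn (t + n%:R) = n.
  by apply: truncn_def; rewrite lerDr t0 -natr1 addrC ltrD2l.
by rewrite addrK.
Qed.

Lemma extension_restricts : restricts_to (extension Phi psi) Phi.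
Proof.
by move=> t eta t01; rewrite -[t in RHS]addr0 (extension_recovery 0).
Qed.

(** On the slab of index [n] the extension coincides with [Phi] after
    [(t, eta) |-> (t - n, psi_n eta)]; at the right end [t = n + 1], where the
    truncation jumps, this is the recovery formula rather than the definition
    of the extension. *)
Lemma extension_continuous :
  jointly_continuous_on (@nonneg_times R) (extension Phi psi).
Proof.
apply: within_continuous_slabs => n.
pose g (p : R * E) := (p.1 - n%:R, iter n psi p.2).
have g_unit p : (`[n%:R, n.+1%:R] `*` [set: E]) p ->
    (@unit_times R `*` [set: E]) (g p).
  rewrite /unit_times /= !in_itv /= -natr1 => -[/andP[np pn] _]; split=> //.
  by rewrite subr_ge0 np lerBlDl.
apply: (@subspace_eq_continuous _ _ _ ((fun p : R * E => Phi p.1 p.2) \o g)).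
  move=> p /set_mem /g_unit [g1 _] /=.
  by rewrite -(extension_recovery n) //= subrK.
apply: within_continuous_precomp g_unit (piece_continuous piece).
apply: continuous_pair => p.
  by apply: cvgB; [exact: cvg_fst | exact: cvg_cst].
by apply: continuous_comp; [exact: cvg_snd | exact: iter_psi_continuous].
Qed.

Lemma extension_solution : generalised_solution (extension Phi psi) psi.
Proof.
split.
- exact: extension_continuous.
- move=> eta; rewrite -extension_restricts ?(piece_time1 piece)//.
  exact: unit_times1.
- move=> eta; rewrite -extension_restricts ?(piece_time0 piece)//.
  exact: unit_times0.
- move=> t t0 eta q; rewrite /extension (iter_shift _ _ psi_shift).
  exact/(piece_shift piece)/unit_times_frac.
- exact: psi_shift.
- move=> t eta t0; rewrite -[t in LHS](subrK (Num.truncn t)%:R) -addrA natr1.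
  rewrite extension_recovery ?iterSr //.
  exact: unit_times_frac.
Qed.

End Piece.
End Solution.

Theorem theorem2p3 (R : realType) (k : nat) (hk : (1 <= k)%N) :
  (forall (phi Phi : R -> 'rV[R]_k -> 'rV[R]_k) (psi : 'rV[R]_k -> 'rV[R]_k),
     generalised_solution phi psi ->
     restricts_to phi Phi ->
     fundamental_piece Phi psi) /\
  (forall (Phi : R -> 'rV[R]_k -> 'rV[R]_k) (psi : 'rV[R]_k -> 'rV[R]_k),
     fundamental_piece Phi psi ->
     (exists phi : R -> 'rV[R]_k -> 'rV[R]_k,
        [/\ recovery_formula phi Phi psi,
            generalised_solution phi psi
          & restricts_to phi Phi]) /\
     (forall phi : R -> 'rV[R]_k -> 'rV[R]_k,
        generalised_solution phi psi ->
        restricts_to phi Phi ->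
        recovery_formula phi Phi psi)).
Proof.
split=> [phi Phi psi|Phi psi piece]; first exact: piece_of_solution.
split=> [|phi]; last exact: recovery_of_solution.
exists (extension R k Phi psi); split.
- exact: extension_recovery.
- exact: extension_solution.
- exact: extension_restricts.
Qed.
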